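(* Let $T$ be a tree with $n\ge 2$ vertices. Then $$F(T)\geq \prod_{v\in V(T)} d(v)!,$$ where $d(v)$ is the degree of $v$ in $T$. Equality holds if and only if $T$ is a path of length $n-1$ or a star.
   Context: For a finite undirected graph $G=(V,E)$, a shelling of $G$ is a total ordering $\sigma(1),\ldots,\sigma(|E|)$ of $E$ such that for every $k=1,\ldots,|E|$ the edges $\sigma(1),\ldots,\sigma(k)$ form a connected subgraph of $G$; $F(G)$ is the number of shellings of $G$. *)

(* Defs.v *)
(* Finite simple graphs as symmetric irreflexive relations. *)
From mathcomp Require Import all_boot.
Set Implicit Arguments. Unset Strict Implicit. Unset Printing Implicit Defensive.

Section Graphs.
Variable T : finType.
Variable e : rel T.

Definition edges : {set {set T}} :=
  [set A : {set T} | [exists x, exists y, e x y && (A == [set x; y])]].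

Definition deg (v : T) : nat := #|[set u | e v u]|.

Definition edge_rel (S : seq {set T}) : rel T :=
  fun u v => has (fun A : {set T} => (u \in A) && (v \in A)) S.
Definition edges_connected (S : seq {set T}) : bool :=
  [forall x, forall y,
     ((x \in \bigcup_(A <- S) A) && (y \in \bigcup_(A <- S) A)) ==>
       connect (edge_rel S) x y].

(* A shelling: an ordering of all edges (given as a permutation of the
   enumeration of the edge set) such that every nonempty prefix forms a
   connected subgraph. *)
Definition is_shelling (s : seq {set T}) : bool :=
  [forall k : 'I_(size s), edges_connected (take k.+1 s)].

(* F(G): number of shellings; permutations returns each ordering of the
   duplicate-free list enum edges exactly once. *)
Definition F : nat := count is_shelling (permutations (enum edges)).

Definition connected_graph : Prop := forall x y : T, connect e x y.
Definition has_cycle : Prop :=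
  exists (x : T) (p : seq T), [/\ 2 <= size p, path e x p, e (last x p) x & uniq (x :: p)].
Definition is_tree : Prop := connected_graph /\ ~ has_cycle.

Definition is_path_graph : Prop :=
  exists s : seq T, perm_eq s (enum T) /\
    forall x y, e x y = (index y s == (index x s).+1) || (index x s == (index y s).+1).

Definition is_star : Prop :=
  exists c : T, forall x y,
    e x y = ((x == c) && (y != c)) || ((y == c) && (x != c)).

End Graphs.

(* Main.v *)
(* The last edge of a shelling of a tree is pendant, and any pendant edge can come
   last, so F(T) is the sum of F(T - l) over the leaves l once T has at least two
   edges.  Write P(T) for the product of the d(v)!; if l hangs from v then
   P(T) = d(v) P(T - l), so by induction F(T) >= P(T) * sum_l 1 / d(v_l), where v_l
   is the neighbour of l.  For a star this sum is 1.  Otherwise the tree obtained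
   by removing all leaves has itself two leaves a and b; in T, all neighbours of
   a but one are leaves, so a contributes (d(a) - 1) / d(a) >= 1/2, and so does b.
   In the equality case d(a) = d(b) = 2 and T has exactly two leaves, hence no
   vertex of degree greater than 2: T is a path. *)
Require Import Defs.
From mathcomp Require Import all_boot.
From mathcomp Require Import zify.
Set Implicit Arguments. Unset Strict Implicit. Unset Printing Implicit Defensive.

(** * Subtrees, paths and leaves *)

Section Trees.
Variable T : finType.
Implicit Types (e : rel T) (x y z l c : T) (p s : seq T).

(* Subtrees keep the vertex type [T]: removed vertices become isolated, and
   contribute the factor 0! = 1 to the product of the factorials. *)
Definition restr (P : pred T) e : rel T := fun x y => [&& e x y, P x & P y].
Definition del l e := restr (predC1 l) e.
Definition leaf e x := deg e x == 1.
(** Vertices of degree 0 are exempt: a deleted leaf stays in [T] as an isolated vertex. *)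
Definition connected_support e : Prop :=
  forall x y, 0 < deg e x -> 0 < deg e y -> connect e x y.

Record tree_like e : Prop := TreeLike {
  tree_sym : symmetric e;
  tree_irr : irreflexive e;
  tree_acyc : ~ has_cycle e;
  tree_conn : connected_support e }.

Lemma restr_sym P e : symmetric e -> symmetric (restr P e).
Proof. by move=> esym x y; rewrite /restr esym [P x && _]andbC. Qed.

Lemma restr_irr P e : irreflexive e -> irreflexive (restr P e).
Proof. by move=> eirr x; rewrite /restr eirr. Qed.

Lemma sub_restr P e : subrel (restr P e) e.
Proof. by move=> x y /and3P[]. Qed.

Lemma restr_acyc P e : ~ has_cycle e -> ~ has_cycle (restr P e).
Proof.
move=> ac [x [p [szp ep elx up]]]; apply: ac; exists x, p; split=> //.
  exact: sub_path (@sub_restr P e) _ _ ep.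
exact: sub_restr elx.
Qed.

Lemma deg_gt0 e x y : e x y -> 0 < deg e x.
Proof. by move=> exy; apply/card_gt0P; exists y; rewrite inE. Qed.

Lemma deg_gt0P e x : reflect (exists y, e x y) (0 < deg e x).
Proof. by apply: (iffP card_gt0P) => -[y]; rewrite ?inE => exy; exists y; rewrite ?inE. Qed.

Lemma leafP e x : reflect (exists2 y, e x y & forall z, e x z -> z = y) (leaf e x).
Proof.
apply: (iffP cards1P) => [[y Ny] | [y exy Ny]]; exists y.
- by have := set11 y; rewrite -Ny inE.
- by move=> z exz; apply/set1P; rewrite -Ny inE.
- by apply/setP=> z; rewrite !inE; apply/idP/eqP => [/Ny | ->].
Qed.

Lemma leaf_nbr e x y z : leaf e x -> e x y -> e x z -> y = z.
Proof. by case/leafP=> w _ Nw /Nw-> /Nw->. Qed.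

Lemma path_del e x y p : y \notin x :: p -> path (del y e) x p = path e x p.
Proof.
elim: p x => //= z p IHp x; rewrite !inE !negb_or => /and3P[yx yz yp].
by rewrite IHp ?inE ?negb_or ?yz // /del /restr /= eq_sym yx eq_sym yz !andbT.
Qed.

(** An edge may map to a path of any length, even 0, so [f] may contract edges. *)
Lemma connect_image e e' (f : T -> T) x y :
  (forall a b, e a b -> connect e' (f a) (f b)) ->
  connect e x y -> connect e' (f x) (f y).
Proof.
move=> ef /connectP[p ep ->]; elim: p x ep => //= z p IHp x /andP[exz /IHp].
exact/connect_trans/ef.
Qed.

(* Otherwise a path from [a] to [b] avoiding [x] closes up to a cycle. *)
Lemma acyclic_branch e x a b : irreflexive e -> ~ has_cycle e ->
  e x a -> e b x -> connect (del x e) a b -> a = b.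
Proof.
move=> eirr ac exa ebx /connectP[p0 ep0 b_last]; rewrite {}b_last in ebx *.
case/shortenP: ep0 ebx => p ep up _ ebx.
apply/eqP/negPn/negP => ab; apply: ac.
have ax : a != x by apply: contraTneq exa => ->; rewrite eirr.
have xp : x \notin a :: p.
  rewrite inE eq_sym negb_or ax /=.
  elim: p a ep {up ab exa ax ebx} => //= y p IHp a /andP[/and3P[_ _ /= yx]] /IHp.
  by rewrite inE eq_sym negb_or yx.
exists x, (a :: p); split=> //=; last by rewrite xp.
- by case: p ab {ep up xp ebx} => //=; rewrite eqxx.
- by rewrite exa; apply: sub_path ep; apply: sub_restr.
Qed.

(** As long as the last vertex is not a leaf, it has a neighbour besides its predecessor, and
    acyclicity keeps that neighbour off the path. The induction is on [#|T| - size p]. *)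
Lemma extend_to_leaf e x p : symmetric e -> irreflexive e -> ~ has_cycle e ->
    path e x p -> uniq (x :: p) -> p != [::] ->
  exists q, [/\ path e x (p ++ q), uniq (x :: p ++ q) & leaf e (last x (p ++ q))].
Proof.
move=> esym eirr ac; have [n] := ubnP (#|T| - size p).
elim: n p => // n IHn p; case/lastP: p => // p y lt_n ep up _.
have [lf|] := boolP (leaf e y).
  by exists [::]; rewrite cats0 last_rcons.
have [epy ewy] : path e x p /\ e (last x p) y.
  by move: ep; rewrite rcons_path => /andP.
have dy : 0 < deg e y by apply: (@deg_gt0 _ _ (last x p)); rewrite esym.
move=> nlf; have [z eyz zw] : exists2 z, e y z & z != last x p.
  have : 0 < #|[set u | e y u] :\ last x p|.
    rewrite -subn_gt0 subn0 lt0n; apply: contra nlf => /eqP D0.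
    by rewrite /leaf /deg (cardsD1 (last x p)) D0 inE esym ewy.
  by case/card_gt0P=> z; rewrite !inE => /andP[? ?]; exists z.
have yp : y \notin x :: p.
  by move: up; rewrite -rcons_cons rcons_uniq => /andP[].
have zp : z \notin x :: rcons p y.
  rewrite -rcons_cons mem_rcons inE negb_or; apply/andP; split.
    by apply: contraTneq eyz => ->; rewrite eirr.
  (* If [z] were on the path, it would be joined to the predecessor of [y] avoiding [y], hence equal
     to it. *)
  apply: contra zw => zp; apply/eqP; apply: (@acyclic_branch e y) => //.
  have ep' : path (del y e) x p by rewrite path_del.
  apply: connect_trans (path_connect ep' (mem_last x p)).
  rewrite (@sym_connect_sym _ (del y e)); first exact: (path_connect ep' zp).
  exact: restr_sym.
have [||||q [eq uq lq]] := IHn (rcons (rcons p y) z).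
- have: size (x :: rcons p y) <= #|T| by rewrite -(card_uniqP up) max_card.
  rewrite /= !size_rcons => le_T; rewrite size_rcons in lt_n.
  by apply: (@leq_trans (#|T| - (size p).+1)) => //; rewrite ltn_sub2l.
- by rewrite rcons_path ep last_rcons.
- by rewrite -rcons_cons rcons_uniq zp.
- by rewrite -size_eq0 size_rcons.
by exists (z :: q); rewrite -cat_rcons.
Qed.

(** A simple path that starts with the edge from [x] to [z] and runs to a leaf never returns to [x],
    so its rest lies in [del x e]. *)
Lemma branch_leaf e x z : symmetric e -> irreflexive e -> ~ has_cycle e ->
  e x z -> exists l, [/\ leaf e l, l != x & connect (del x e) z l].
Proof.
move=> esym eirr ac exz.
have xz : x != z by apply: contraTneq exz => ->; rewrite eirr.
have [|||q [/= /andP[_ eq] /andP[xq uq] lf]] := @extend_to_leaf e x [:: z] esym eirr ac.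
- by rewrite /= exz.
- by rewrite /= inE xz.
- by [].
exists (last z q); split=> //.
- by apply: contraNneq xq => <-; rewrite mem_last.
- by apply/connectP; exists q; rewrite // path_del.
Qed.

Lemma two_leaves e x z : symmetric e -> irreflexive e -> ~ has_cycle e ->
  e x z -> exists l r, [/\ leaf e l, leaf e r & l != r].
Proof.
move=> esym eirr ac exz.
have [l [lf _ _]] := branch_leaf esym eirr ac exz.
have /leafP[m elm _] := lf.
have [r [rf rl _]] := branch_leaf esym eirr ac elm.
by exists l, r; rewrite eq_sym.
Qed.

(** Each neighbour of [x] leads to a leaf without passing [x]; two neighbours sharing a leaf would
    be connected in [del x e], hence equal by [acyclic_branch]. *)
Lemma deg_le_leaves e x : symmetric e -> irreflexive e -> ~ has_cycle e ->
  deg e x <= #|[set l | leaf e l]|.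
Proof.
move=> esym eirr ac.
have /fin_all_exists[f fP] z :
    exists l, e x z -> leaf e l && connect (del x e) z l.
  have [exz|] := boolP (e x z); last by exists x.
  by have [l [lf _ zl]] := branch_leaf esym eirr ac exz; exists l; rewrite lf.
rewrite /deg -(@card_in_imset _ _ f).
  apply/subset_leq_card/subsetP=> _ /imsetP[z exz ->].
  by rewrite !inE in exz *; case/andP: (fP z exz).
move=> a b; rewrite !inE => exa exb fab.
apply: (acyclic_branch eirr ac exa); first by rewrite esym.
case/andP: (fP a exa) => _ /connect_trans; apply.
rewrite fab sym_connect_sym; last exact: restr_sym.
by case/andP: (fP b exb).
Qed.

Lemma connected_closed e (A : {pred T}) x : symmetric e -> connected_support e ->
  (forall a b, a \in A -> e a b -> b \in A) ->
  x \in A -> 0 < deg e x -> forall y, 0 < deg e y -> y \in A.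
Proof.
move=> esym conn Acl xA dx y dy.
have clA : closed e A.
  by apply: intro_closed => [|a b eab aA]; [apply: sym_connect_sym | apply: Acl eab].
by rewrite -(closed_connect clA (conn x y dx dy)).
Qed.

(** Two adjacent leaves would form a component by themselves, without room for [c]. *)
Lemma leaf_adjacent e c x y : symmetric e -> connected_support e -> 1 < deg e c ->
  e x y -> leaf e x -> ~~ leaf e y.
Proof.
move=> esym conn dc exy lx; apply/negP => ly.
have: c \in [set x; y].
  apply: (@connected_closed e _ x); rewrite ?inE ?eqxx ?(ltnW dc) //; last exact: deg_gt0 exy.
  move=> a b; rewrite !inE => /orP[]/eqP-> e1.
    by rewrite (leaf_nbr lx e1 exy) eqxx orbT.
  by rewrite (leaf_nbr ly e1 (etrans (esym _ _) exy)) eqxx.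
by rewrite !inE => /orP[]/eqP c_eq; move: dc; rewrite c_eq ?(eqP lx) ?(eqP ly).
Qed.

Lemma deg_restr P e x : deg (restr P e) x <= deg e x.
Proof. by apply/subset_leq_card/subsetP=> y; rewrite !inE => /sub_restr. Qed.

(** * Deleting a leaf *)

Section Pruning.
Variables (e : rel T) (l v : T).
Hypotheses (esym : symmetric e) (eirr : irreflexive e).
Hypotheses (lf : leaf e l) (elv : e l v).

Let vl : v != l. Proof. by apply: contraTneq elv => ->; rewrite eirr. Qed.

Lemma deg_del_leaf : deg (del l e) l = 0.
Proof. by apply: eq_card0 => z; rewrite !inE /del /restr /= eqxx andbF. Qed.

Lemma deg_del_nbr : deg e v = (deg (del l e) v).+1.
Proof.
rewrite /deg (cardsD1 l) inE esym elv add1n; congr _.+1.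
by apply: eq_card => z; rewrite !inE /del /restr /= vl /= andbC.
Qed.

Lemma deg_del_other z : z != l -> z != v -> deg (del l e) z = deg e z.
Proof.
move=> zl zv; apply: eq_card => y; rewrite !inE /del /restr /= zl /=.
have [ezy|//] := boolP (e z y); apply: contraNneq zv => yl.
by rewrite (@leaf_nbr e l z v lf) // esym -yl.
Qed.

(** [l] passes from 1! to 0!, [v] loses exactly its factor d(v), and every other degree is
    unchanged. *)
Lemma prod_deg_del :
  \prod_(z : T) (deg e z)`! = deg e v * \prod_(z : T) (deg (del l e) z)`!.
Proof.
rewrite (bigD1 v) //= [in RHS](bigD1 v) //= mulnA deg_del_nbr factS; congr (_ * _).
apply: eq_bigr => z zv; have [->|zl] := eqVneq z l.
  by rewrite deg_del_leaf (eqP lf).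
by rewrite deg_del_other.
Qed.

(* Contracting the edge from [l] to [v] turns [e]-paths into [del l e]-paths. *)
Lemma connected_del : connected_support e -> connected_support (del l e).
Proof.
move=> conn x y dx dy.
have xl z : 0 < deg (del l e) z -> z != l.
  by move=> dz; apply: contraTneq dz => ->; rewrite deg_del_leaf.
pose f z := if z == l then v else z.
have fE z : z != l -> f z = z by rewrite /f => /negPf->.
have fl : f l = v by rewrite /f eqxx.
rewrite -(fE x (xl x dx)) -(fE y (xl y dy)); apply: connect_image (conn x y _ _).
- move=> a b eab; have [al|al] := eqVneq a l.
    rewrite al in eab *.
    by rewrite (leaf_nbr lf eab elv) fl (fE v vl).
  have [bl|bl] := eqVneq b l.
    by rewrite bl esym in eab *; rewrite (leaf_nbr lf eab elv) fl (fE v vl).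
  by rewrite !fE //; apply: connect1; rewrite /del /restr /= eab al.
- exact: leq_trans dx (deg_restr _ _ _).
- exact: leq_trans dy (deg_restr _ _ _).
Qed.

Lemma edges_del : edges (del l e) = edges e :\ [set l; v].
Proof.
apply/setP=> A; rewrite !inE; apply/idP/andP.
  case/existsP=> x /existsP[y /andP[/and3P[exy /= xl yl] /eqP->]]; split.
    apply/eqP=> /setP/(_ l); rewrite !inE eqxx /= ![l == _]eq_sym.
    by rewrite (negPf xl) (negPf yl).
  by apply/existsP; exists x; apply/existsP; exists y; rewrite exy eqxx.
case=> Alv /existsP[x /existsP[y /andP[exy /eqP defA]]].
apply/existsP; exists x; apply/existsP; exists y; rewrite defA eqxx andbT.
apply/and3P; split=> //=; apply: contra_neq Alv => xl; rewrite defA.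
  by rewrite xl in exy *; rewrite (leaf_nbr lf exy elv).
by rewrite xl esym in exy *; rewrite (leaf_nbr lf exy elv) setUC.
Qed.
End Pruning.

Lemma tree_del e l : tree_like e -> leaf e l -> tree_like (del l e).
Proof.
case=> esym eirr ac conn lf; have /leafP[v elv _] := lf.
split; [exact: restr_sym | exact: restr_irr | exact: restr_acyc |].
exact: connected_del elv conn.
Qed.

(** * Shellings by their last edge *)

(** Every ordering of a nonempty list splits uniquely into its last element and an ordering of the
    rest. *)
Lemma count_permutations_rcons (A : eqType) (P : pred (seq A)) (r : seq A) :
  uniq r -> r != [::] ->
  count P (permutations r) =
    \sum_(a <- r) count (fun t => P (rcons t a)) (permutations (rem a r)).
Proof.
move=> ur rn0.
have -> : \sum_(a <- r) count (fun t => P (rcons t a)) (permutations (rem a r)) =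
    count P [seq rcons t a | a <- r, t <- permutations (rem a r)].
  rewrite count_flatten -map_comp sumnE big_map; apply: eq_bigr => a _ /=.
  by rewrite count_map.
apply/permP/uniq_perm; first exact: permutations_uniq.
  apply: allpairs_uniq_dep => // [a _|]; first exact: permutations_uniq.
  move=> [a t] [b u] _ _ /= /eqP.
  by rewrite eqseq_rcons => /andP[/eqP-> /eqP->].
move=> t; rewrite mem_permutations; apply/idP/allpairsPdep.
  case/lastP: t => [|t a] pt.
    by case: r ur rn0 pt => // ? ? _ _ /perm_size.
  have ar : a \in r by rewrite -(perm_mem pt) mem_rcons mem_head.
  exists a, t; split=> //; rewrite mem_permutations -(perm_cons a).
  by rewrite -(perm_rcons a t) (permPl pt) perm_to_rem.
case=> a [u [ar]]; rewrite mem_permutations => pu ->.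
by rewrite perm_rcons (permPr (perm_to_rem ar)) perm_cons.
Qed.

Lemma edgesP e (A : {set T}) :
  reflect (exists x y, e x y /\ A = [set x; y]) (A \in edges e).
Proof.
rewrite inE; apply: (iffP existsP) => -[x].
  by case/existsP=> y /andP[exy /eqP]; exists x, y.
by case=> y [exy ->]; exists x; apply/existsP; exists y; rewrite exy eqxx.
Qed.

Lemma edge_in e x y : e x y -> [set x; y] \in edges e.
Proof. by move=> exy; apply/edgesP; exists x, y. Qed.

Lemma edge_mem e x y (A : {set T}) : symmetric e ->
  A \in edges e -> x \in A -> y \in A -> x != y -> e x y /\ A = [set x; y].
Proof.
move=> esym /edgesP[a [b [eab ->]]]; rewrite !inE.
by case/orP=> /eqP-> /orP[]/eqP->; rewrite ?eqxx // => _; rewrite 1?esym 1?setUC.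
Qed.

Lemma is_shelling_rcons (s : seq {set T}) A :
  is_shelling (rcons s A) = is_shelling s && edges_connected (rcons s A).
Proof.
have shP (u : seq {set T}) :
    reflect (forall k, k < size u -> edges_connected (take k.+1 u)) (is_shelling u).
  by apply: (iffP forallP) => [sh k lt_k | sh k]; [apply: (sh (Ordinal lt_k)) | apply: sh].
have takeL k : k < size s -> take k.+1 (rcons s A) = take k.+1 s.
  by move=> lt_k; rewrite -cats1 takel_cat.
apply/shP/andP => [sh | [/shP sh shA] k].
  split; last by have := sh (size s); rewrite size_rcons take_oversize ?size_rcons //; apply.
  by apply/shP=> k lt_k; rewrite -takeL // sh // size_rcons ltnW.
rewrite size_rcons ltnS leq_eqVlt => /predU1P[->|lt_k].
  by rewrite take_oversize ?size_rcons.
by rewrite takeL // sh.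
Qed.

Lemma is_shelling_connected (s : seq {set T}) :
  is_shelling s -> s != [::] -> edges_connected s.
Proof. by case/lastP: s => // s A; rewrite is_shelling_rcons => /andP[]. Qed.

Lemma mem_bigcup_seq (s : seq {set T}) x :
  reflect (exists2 A, A \in s & x \in A) (x \in \bigcup_(A <- s) A).
Proof. by rewrite bigcup_seq; apply: bigcupP. Qed.

Lemma edges_connected_tree e (s : seq {set T}) :
  connected_support e -> symmetric e -> s =i edges e -> edges_connected s.
Proof.
move=> conn esym defs; apply/forallP=> x; apply/forallP=> y; apply/implyP.
have deg_s z : z \in \bigcup_(A <- s) A -> 0 < deg e z.
  case/mem_bigcup_seq=> A; rewrite defs => /edgesP[a [b [eab ->]]] zab.
  apply/deg_gt0P; case/set2P: zab => ->; first by exists b.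
  by exists a; rewrite esym.
case/andP=> /deg_s dx /deg_s dy.
apply: (connect_image (f := id)) (conn x y dx dy) => a b eab; apply: connect1.
apply/hasP; exists [set a; b]; first by rewrite defs edge_in.
by rewrite set21 set22.
Qed.

(** If both ends had other edges, these would lie in [s], and the connected [s] would join [x] to
    [y] without the edge between them, closing a cycle. *)
Lemma shelling_last_leaf e x y (s : seq {set T}) :
  symmetric e -> irreflexive e -> ~ has_cycle e ->
  s =i edges e :\ [set x; y] -> e x y -> is_shelling s -> leaf e x || leaf e y.
Proof.
move=> esym eirr ac defs exy sh; apply/negPn/negP => /norP[nx ny].
have xy : x != y by apply: contraTneq exy => ->; rewrite eirr.
have other a b : e a b -> ~~ leaf e a -> [set a; b] = [set x; y] ->
    exists2 A, A \in s & a \in A.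
  move=> eab na defab.
  have [c] : exists c, c \in [set u | e a u] :\ b.
    apply/card_gt0P; move: na; rewrite /leaf /deg (cardsD1 b) inE eab.
    by rewrite lt0n; apply: contra => /eqP->.
  rewrite !inE => /andP[cb eac]; exists [set a; c]; last exact: set21.
  rewrite defs -defab; apply/setD1P; split; last exact: edge_in.
  apply: contra_neq cb => defac; have : c \in [set a; b] by rewrite -defac set22.
  by case/set2P=> // ca; rewrite ca eirr in eac.
have [A As xA] := other x y exy nx erefl.
have [B Bs yB] := other y x (etrans (esym _ _) exy) ny (setUC _ _).
have /forallP/(_ x)/forallP/(_ y)/implyP conn : edges_connected s.
  by apply: is_shelling_connected sh _; case: (s) As.
pose e' u v := e u v && ([set u; v] != [set x; y]).
have : connect e' x y.
  apply: (connect_image (f := id)) (conn _); last first.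
    by apply/andP; split; apply/mem_bigcup_seq; [exists A | exists B].
  move=> a b /hasP[C]; rewrite defs => /setD1P[nC eC] /andP[aC bC].
  have [->|ab] := eqVneq a b; first exact: connect0.
  have [eab defC] := edge_mem esym eC aC bC ab.
  by apply: connect1; rewrite /e' eab -defC.
case/connectP=> p0 ep0 y_last; apply: ac.
case/shortenP: ep0 y_last => p ep up _ y_last.
exists x, p; split=> //; last by rewrite -y_last esym.
  (* An empty [p] would give x = y; a single step would be the edge excluded from [e']. *)
  case: p y_last ep {up} => [|z [|//]] /= yz; first by rewrite yz eqxx in xy.
  by rewrite -yz /e' eqxx andbF.
by apply: sub_path ep => u v /andP[].
Qed.

Lemma mem_rem_enum (U : finType) (X : {set U}) a : rem a (enum X) =i X :\ a.
Proof. by move=> b; rewrite mem_rem_uniq ?enum_uniq // !inE mem_enum. Qed.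

(** An ordering ending in a pendant edge is a shelling exactly when the rest is one, and no shelling
    ends in another edge. As [1 < deg e c], a pendant edge has only one leaf end, so pendant edges
    correspond to leaves. *)
Lemma F_rec e c : tree_like e -> 1 < deg e c ->
  F e = \sum_(l | leaf e l) F (del l e).
Proof.
move=> [esym eirr ac conn] dc.
pose N (A : {set T}) :=
  count (fun t => is_shelling (rcons t A)) (permutations (rem A (enum (edges e)))).
have F_last : F e = \sum_(A in edges e) N A.
  rewrite /F count_permutations_rcons ?enum_uniq ?big_enum //.
  have /deg_gt0P[x ecx] := ltnW dc; apply: contraTneq (edge_in ecx) => edges0.
  by rewrite -mem_enum edges0.
have mem_last A (t : seq {set T}) : A \in edges e ->
    t \in permutations (rem A (enum (edges e))) ->
    t =i edges e :\ A /\ rcons t A =i edges e.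
  rewrite mem_permutations => eA pt; split=> B.
    by rewrite (perm_mem pt) mem_rem_enum.
  rewrite mem_rcons inE (perm_mem pt) mem_rem_enum in_setD1.
  by case: eqVneq => [->|].
have /fin_all_exists[v vP] l : exists v, leaf e l -> e l v.
  by have [/leafP[v elv _]|_] := boolP (leaf e l); [exists v | exists l].
pose h l := [set l; v l].
have N_leaf l : leaf e l -> N (h l) = F (del l e).
  move=> lf; have elv := vP l lf.
  rewrite /N /F (edges_del esym lf elv).
  have /perm_permutations/permP-> :
      perm_eq (enum (edges e :\ h l)) (rem (h l) (enum (edges e))).
    apply: uniq_perm; rewrite ?rem_uniq ?enum_uniq // => A.
    by rewrite mem_rem_enum mem_enum.
  apply: eq_in_count => t /(mem_last _ _ (edge_in elv))[_ mem_t].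
  by rewrite is_shelling_rcons (edges_connected_tree conn esym mem_t) andbT.
have N_inner A : A \in edges e -> A \notin h @: [set l | leaf e l] -> N A = 0.
  move=> eA; have /edgesP[x [y [exy defA]]] := eA.
  apply: contraNeq; rewrite -lt0n -has_count => /hasP[t /(mem_last _ _ eA)[mem_t _]].
  rewrite is_shelling_rcons => /andP[sh _]; rewrite defA in mem_t *.
  case/orP: (shelling_last_leaf esym eirr ac mem_t exy sh) => lf.
    by rewrite (leaf_nbr lf exy (vP x lf)); apply: (imset_f h); rewrite inE.
  rewrite setUC (leaf_nbr lf (etrans (esym _ _) exy) (vP y lf)).
  by apply: (imset_f h); rewrite inE.
have h_sub : h @: [set l | leaf e l] \subset edges e.
  apply/subsetP=> _ /imsetP[l lf ->]; rewrite inE in lf.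
  exact/edge_in/vP.
rewrite F_last (big_setID (h @: [set l | leaf e l])) /= (setIidPr h_sub).
rewrite [X in _ + X]big1 ?addn0; last by move=> A /setDP[]; apply: N_inner.
(* [h] is injective on leaves, since [leaf_adjacent] excludes an edge with two leaf ends. *)
rewrite big_imset /= => [|l r]; last first.
  rewrite !inE => lf rf hlr; have: l \in h r by rewrite -hlr set21.
  case/set2P=> // lv; case/negP: (leaf_adjacent esym conn dc (vP r rf) rf).
  by rewrite -lv.
by apply: eq_big => l; rewrite inE // => /N_leaf.
Qed.

(** * The product of factorials and trees with at most one edge *)

Definition deg_prod e := \prod_(x : T) (deg e x)`!.

Lemma deg_prod_gt0 e : 0 < deg_prod e.
Proof. by apply: prodn_gt0 => x; apply: fact_gt0. Qed.

(** The base of the induction. Without edges, the empty ordering is the only shelling. *)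
Lemma small_tree e : tree_like e -> (forall x, deg e x <= 1) ->
  F e = 1 /\ deg_prod e = 1.
Proof.
case=> esym eirr ac conn de; split; last first.
  by apply: big1 => x _; case: (deg e x) (de x) => [|[]].
have edges_le1 : #|edges e| <= 1.
  apply/card_le1_eqP=> A B /edgesP[x [y [exy ->]]] /edgesP[a [b [eab ->]]].
  have lf z t : e z t -> leaf e z by move=> /deg_gt0; rewrite /leaf eqn_leq de.
  have cl : forall z, 0 < deg e z -> z \in [set x; y].
    apply: (@connected_closed e _ x esym conn); rewrite ?set21 ?(deg_gt0 exy) //.
    have eyx : e y x by rewrite esym.
    move=> z t /set2P[]-> ezt; first by rewrite (leaf_nbr (lf _ _ ezt) ezt exy) set22.
    by rewrite (leaf_nbr (lf _ _ ezt) ezt eyx) set21.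
  have ab : a != b by apply: contraTneq eab => ->; rewrite eirr.
  have /set2P[] := cl a (deg_gt0 eab);
  have /set2P[] := cl b (deg_gt0 (etrans (esym _ _) eab)) => bE aE;
    rewrite aE bE ?eqxx // in ab *.
  by rewrite setUC.
have sh0 : is_shelling ([::] : seq {set T}) by apply/forallP=> -[].
rewrite /F; move: edges_le1; rewrite cardE; case defE: (enum _) => [|A [|//]] _ /=.
  by rewrite sh0.
rewrite (is_shelling_rcons [::] A) sh0 (edges_connected_tree conn esym) // => B.
by rewrite -[RHS]mem_enum defE.
Qed.

(** * Trees of maximum degree two *)

(** [index] returns [size s] off [s], so an outside element would pass as adjacent to the last one;
    hence the membership conditions that accompany this relation. *)
Definition adjacent_in s x y :=
  (index y s == (index x s).+1) || (index x s == (index y s).+1).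

Lemma nbr_of_two e x a b y : deg e x <= 2 ->
  e x a -> e x b -> a != b -> e x y -> y = a \/ y = b.
Proof.
move=> dx exa exb ab exy; apply/set2P.
have -> : [set a; b] = [set z | e x z]; last by rewrite inE.
apply/eqP; rewrite eqEcard cards2 ab dx andbT.
by apply/subsetP=> z /set2P[]->; rewrite inE.
Qed.

(** A path from one leaf to another already contains both neighbours of its inner vertices and the
    only neighbour of each end, so it is closed under adjacency and carries every edge. *)
Lemma tree_path e a b : tree_like e -> (forall x, deg e x <= 2) -> e a b ->
  exists2 s, uniq s & forall x y, e x y = [&& x \in s, y \in s & adjacent_in s x y].
Proof.
move=> [esym eirr ac conn] de eab.
have [x [_ [lx _ _]]] := two_leaves esym eirr ac eab.
have /leafP[z exz _] := lx.
have [|||q [eq uq lq]] := @extend_to_leaf e x [:: z] esym eirr ac.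
- by rewrite /= exz.
- by rewrite /= inE andbT; apply: contraTneq exz => ->; rewrite eirr.
- by [].
set s := x :: [:: z] ++ q in uq; exists s => //.
have e_nth i : i.+1 < size s -> e (nth x s i) (nth x s i.+1).
  by move=> lt_i; apply: (pathP x eq).
have nbr_nth i y : i < size s -> e (nth x s i) y ->
    exists j, [/\ j < size s, y = nth x s j & (j == i.+1) || (i == j.+1)].
  case: i => [|k] lt_k ey.
    by exists 1; split=> //; apply: leaf_nbr lx ey exz.
  have e_k : e (nth x s k.+1) (nth x s k) by rewrite esym e_nth.
  have [lt_k2 | ge_k2] := ltnP k.+2 (size s).
    have [|->|->] := nbr_of_two (de _) e_k (e_nth k.+1 lt_k2) _ ey.
    - by rewrite nth_uniq ?(ltnW lt_k) // neq_ltn leqnSn.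
    - by exists k; rewrite eqxx orbT (ltnW lt_k).
    - by exists k.+2; rewrite eqxx.
  (* Here [k.+1] is the last index, and the last vertex is a leaf. *)
  exists k; rewrite eqxx orbT (ltnW lt_k); split=> //.
  apply: leaf_nbr ey e_k; suff -> : nth x s k.+1 = last x ([:: z] ++ q) by [].
  by rewrite (last_nth x); congr nth; apply/eqP; rewrite eqn_leq -ltnS lt_k -ltnS.
have in_s y : 0 < deg e y -> y \in s.
  apply: (@connected_closed e (mem s) x esym conn); rewrite ?mem_head ?(deg_gt0 exz) //.
  move=> u v us; rewrite -{1}(nth_index x us) => /nbr_nth[]; first by rewrite index_mem.
  by move=> j [lt_j -> _]; apply: mem_nth.
move=> u v; apply/idP/and3P => [euv | [us vs /orP[]/eqP uv]].
- have u_s := in_s u (deg_gt0 euv).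
  split=> //; first by apply: in_s; apply: deg_gt0 (u) _; rewrite esym.
  have [||j [lt_j -> adj]] := nbr_nth (index u s) v; rewrite ?index_mem ?nth_index //.
  by rewrite /adjacent_in (index_uniq _ lt_j uq).
- by rewrite -(nth_index x us) -(nth_index x vs) uv e_nth // -uv index_mem.
- by rewrite esym -(nth_index x us) -(nth_index x vs) uv e_nth // -uv index_mem.
Qed.

Lemma adjacent_in_nth s x y x0 : y \in s -> adjacent_in s x y ->
  y = nth x0 s (index x s).-1 \/ y = nth x0 s (index x s).+1.
Proof.
move=> ys /orP[]/eqP xy; [right | left]; first by rewrite -xy nth_index.
by rewrite xy nth_index.
Qed.

Lemma deg_path_le2 e s : (forall x y, e x y -> y \in s /\ adjacent_in s x y) ->
  forall x, deg e x <= 2.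
Proof.
(* At an end of [s], the truncated [.-1] or the default of [nth] may give a spurious element; only
   the bound on the size matters. *)
move=> eE x; pose N := [set nth x s (index x s).-1; nth x s (index x s).+1].
apply: (@leq_trans #|N|); last by rewrite cards2; case: (_ != _).
apply/subset_leq_card/subsetP=> y; rewrite !inE => /eE[ys /(adjacent_in_nth x ys)].
by case=> ->; rewrite eqxx ?orbT.
Qed.

(** An inner vertex of [s] is adjacent to its predecessor and its successor, which differ, so a leaf
    can only be an end. *)
Lemma leaves_path_le2 e s : uniq s ->
  (forall x y, e x y = [&& x \in s, y \in s & adjacent_in s x y]) ->
  #|[set l | leaf e l]| <= 2.
Proof.
move=> us eE; case: s us eE => [|h t] us eE.
  rewrite (eq_card0 (A := [set l | leaf e l])) // => l; rewrite !inE.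
  by apply/negP=> /leafP[y]; rewrite eE.
apply: (@leq_trans #|[set h; last h t]|); last by rewrite cards2; case: (_ != _).
apply/subset_leq_card/subsetP=> l; rewrite inE => lf.
have /leafP[y ely _] := lf; have ls : l \in h :: t by move: ely; rewrite eE => /and3P[].
set s := h :: t in us eE ls; rewrite -(nth_index h ls).
have : index l s < size s by rewrite index_mem.
case def_i: (index l s) => [|i] lt_i; first by rewrite set21.
have [lt_i2 | ge_i2] := ltnP i.+2 (size s); last first.
  rewrite (_ : nth h s i.+1 = last h t) ?set22 // (last_nth h); congr nth.
  by apply/eqP; rewrite eqn_leq -ltnS lt_i -ltnS.
have e_l j : j < size s -> (j == i.+2) || (i.+1 == j.+1) -> e l (nth h s j).
  by move=> lt_j adj; rewrite eE ls mem_nth // /adjacent_in def_i index_uniq.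
have := leaf_nbr lf (e_l i (ltnW lt_i) _) (e_l i.+2 lt_i2 _).
rewrite !eqxx orbT => /(_ isT isT) /eqP.
by rewrite nth_uniq ?(ltnW lt_i) // ltn_eqF.
Qed.

(** * Induction on the number of edges *)

(** Unlike [is_star], this allows isolated vertices and passes to subgraphs, as the induction
    requires. *)
Definition starlike e := exists c, forall x y, e x y -> x = c \/ y = c.

(** There are exactly two leaves, and each hangs from a vertex of degree 2, so twice each term of
    [F_rec] is [deg_prod e]. *)
Lemma F_path e c : tree_like e -> (forall x, deg e x <= 2) -> 1 < deg e c ->
  (forall l, leaf e l -> F (del l e) = deg_prod (del l e)) -> F e = deg_prod e.
Proof.
move=> te de dc IH; have [esym eirr ac conn] := te.
have /deg_gt0P[b ecb] := ltnW dc.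
have [s us eE] := tree_path te de ecb.
have leaves2 : #|[set l | leaf e l]| = 2.
  apply/eqP; rewrite eqn_leq (leaves_path_le2 us eE) /=.
  exact: leq_trans dc (deg_le_leaves c esym eirr ac).
apply/eqP; rewrite -(eqn_pmul2l (m := 2)) // (F_rec te dc) big_distrr /=.
rewrite (eq_bigr (fun _ => deg_prod e)) => [|l lf].
  by rewrite -big_set sum_nat_const leaves2.
have /leafP[v elv _] := lf; rewrite IH // /deg_prod (prod_deg_del esym eirr lf elv).
congr (_ * _); apply/eqP; rewrite eqn_leq de andbT.
have := leaf_adjacent esym conn dc elv lf; rewrite /leaf.
by rewrite esym in elv; have := deg_gt0 elv; case: (deg e v) => [|[]].
Qed.

(** The leaves are the [deg e c] neighbours of [c], and all hang from [c], so [deg e c] times each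
    term of [F_rec] is [deg_prod e]. *)
Lemma F_star e c : tree_like e -> starlike e -> 1 < deg e c ->
  (forall l, leaf e l -> F (del l e) = deg_prod (del l e)) -> F e = deg_prod e.
Proof.
move=> te [c' star] dc IH; have [esym eirr ac conn] := te.
have {}star x y : e x y -> x = c \/ y = c.
  (* Were [c'] another vertex, every edge at [c] would end in [c'], against [1 < deg e c]. *)
  suff <- : c' = c by apply: star.
  apply/eqP/negPn/negP => c'c; move: dc; rewrite ltnNge => /negP[].
  apply: (@leq_trans #|[set c']|); last by rewrite cards1.
  apply/subset_leq_card/subsetP=> z; rewrite !inE => /star[c_eq|->//].
  by rewrite c_eq eqxx in c'c.
have leafE l : leaf e l = e c l.
  apply/idP/idP => [lf|ecl].
    have /leafP[v elv _] := lf; case: (star _ _ elv) => [lc|<-]; last by rewrite esym.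
    by rewrite lc /leaf (gtn_eqF dc) in lf.
  apply/leafP; exists c; first by rewrite esym.
  move=> z elz; case: (star _ _ elz) => // lc; by rewrite lc eirr in ecl.
apply/eqP; rewrite -(eqn_pmul2l (ltnW dc)) (F_rec te dc) big_distrr /=.
rewrite (eq_bigr (fun _ => deg_prod e)) => [|l lf].
  by rewrite (eq_bigl _ _ leafE) -big_set sum_nat_const.
rewrite IH // /deg_prod (prod_deg_del esym eirr lf (v := c)) //.
by rewrite esym -leafE.
Qed.

(** * The tree without its leaves *)

Definition inner e := restr (fun x => ~~ leaf e x) e.

(** All neighbours of [c] are leaves, so [c] and its neighbours are closed under adjacency and carry
    every edge. *)
Lemma starlike_inner e c : tree_like e -> 1 < deg e c ->
  (forall x y, ~~ inner e x y) -> starlike e.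
Proof.
move=> [esym eirr ac conn] dc no_inner; exists c.
have nc : ~~ leaf e c by rewrite /leaf gtn_eqF.
have lf y : e c y -> leaf e y.
  by move=> ecy; have := no_inner c y; rewrite /inner /restr ecy nc /= negbK.
have cl x : 0 < deg e x -> (x == c) || e c x.
  apply: (@connected_closed e [pred x | (x == c) || e c x] c esym conn) => //=.
  - move=> a b; rewrite !inE => /orP[/eqP->|eca eab]; first by move->; rewrite orbT.
    by rewrite (leaf_nbr (lf _ eca) eab (etrans (esym _ _) eca)) eqxx.
  - by rewrite inE eqxx.
  - exact: ltnW.
move=> x y exy; case/orP: (cl x (deg_gt0 exy)) => [/eqP|ecx]; first by left.
by right; apply: (leaf_nbr (lf _ ecx) exy); rewrite esym.
Qed.

Definition leaf_nbrs e a := [set l | leaf e l && e a l].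

(** All neighbours of [a] are leaves of [e], except its single neighbour in [inner e]. *)
Lemma deg_inner_leaf e a : leaf (inner e) a ->
  [/\ deg e a = #|leaf_nbrs e a|.+1 & 1 < deg e a].
Proof.
move=> lf; have /leafP[b /and3P[eab na _] _] := lf.
split; last by move: na (deg_gt0 eab); rewrite /leaf; case: (deg e a) => [|[]].
rewrite /deg -(cardsID [set l | leaf e l]) -addn1; congr (_ + _).
  by apply: eq_card => l; rewrite !inE andbC.
rewrite -(eqP lf); apply: eq_card => l; rewrite !inE /inner /restr na /=.
by rewrite andbC.
Qed.

(** Each term times d(a) is [deg_prod e], so d(a) S = (d(a) - 1) [deg_prod e] with d(a) at least 2.
    Hence S is at least half of [deg_prod e], with equality only for d(a) = 2. *)
Lemma sum_inner_leaf e a (S := \sum_(l in leaf_nbrs e a) deg_prod (del l e)) :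
  tree_like e -> leaf (inner e) a ->
  deg_prod e <= 2 * S /\ (2 * S <= deg_prod e -> #|leaf_nbrs e a| = 1).
Proof.
case=> esym eirr ac conn /deg_inner_leaf[da d_gt1].
have dS : deg e a * S = #|leaf_nbrs e a| * deg_prod e.
  rewrite big_distrr -sum_nat_const; apply: eq_bigr => l; rewrite inE => /andP[lf eal].
  by rewrite [RHS](prod_deg_del esym eirr lf (v := a)) // esym.
move: dS d_gt1 (deg_prod_gt0 e); rewrite da; move: #|_| (deg_prod e) S => k P S.
by split; nia.
Qed.

(* In [F_rec], the leaves hanging from [a] and those hanging from [b], for two
   leaves [a] != [b] of [inner e], each account for at least half of [deg_prod e]. *)
Lemma F_inner e x y c : tree_like e -> inner e x y -> 1 < deg e c ->
  (forall l, leaf e l -> deg_prod (del l e) <= F (del l e)) ->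
  deg_prod e <= F e /\ (F e = deg_prod e -> forall z, deg e z <= 2).
Proof.
move=> te exy dc IH; have [esym eirr ac conn] := te.
have [a [b [lfa lfb ab]]] :=
  two_leaves (restr_sym _ esym) (restr_irr _ eirr) (restr_acyc ac) exy.
have [Sa Sa1] := sum_inner_leaf te lfa; have [Sb Sb1] := sum_inner_leaf te lfb.
pose U := leaf_nbrs e a :|: leaf_nbrs e b.
have disj : [disjoint leaf_nbrs e a & leaf_nbrs e b].
  apply/pred0Pn => -[l]; rewrite !inE => /andP[/andP[lf eal] /andP[_ ebl]].
  by rewrite (@leaf_nbr e l a b lf) ?eqxx // esym in ab.
have sumU : \sum_(l in U) deg_prod (del l e) =
    \sum_(l in leaf_nbrs e a) deg_prod (del l e) +
    \sum_(l in leaf_nbrs e b) deg_prod (del l e).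
  by rewrite -bigU //; apply: eq_bigl => l; rewrite !inE.
have subU : U \subset [set l | leaf e l].
  by apply/subsetP=> l; rewrite !inE => /orP[]/andP[].
have F_ge : \sum_(l in U) deg_prod (del l e) +
    \sum_(l in [set l | leaf e l] :\: U) deg_prod (del l e) <= F e.
  have -> : F e = \sum_(l in [set l | leaf e l]) F (del l e).
    by rewrite (F_rec te dc) big_set.
  rewrite [leqRHS](big_setID U) /= (setIidPr subU).
  apply: leq_add; apply: leq_sum => l; last by rewrite !inE => /andP[_ /IH].
  by move/(subsetP subU); rewrite inE => /IH.
split=> [|FP z]; first by move: F_ge; rewrite sumU; lia.
(* The leaves in [U] already account for [deg_prod e], and any other leaf would add a positive
   amount. *)
have rest0 : [set l | leaf e l] :\: U = set0.
  apply/eqP; rewrite -[_ == _]negbK; apply/set0Pn => -[l lD].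
  have : 0 < \sum_(r in [set r | leaf e r] :\: U) deg_prod (del r e).
    by rewrite (bigD1 l) //= addn_gt0 deg_prod_gt0.
  by move: F_ge; rewrite FP sumU; lia.
(* By equality one leaf hangs from [a] and one from [b], so [U], now the set of all leaves, has at
   most two elements. *)
apply: leq_trans (deg_le_leaves z esym eirr ac) _.
have -> : [set l | leaf e l] = U.
  by apply/eqP; rewrite eqEsubset subU -setD_eq0 rest0 eqxx.
apply: leq_trans (leq_card_setU _ _) _.
by rewrite Sa1 ?Sb1 //; move: F_ge; rewrite FP sumU; lia.
Qed.

Lemma tree_like_bound e : tree_like e ->
  deg_prod e <= F e /\ (F e = deg_prod e <-> (forall x, deg e x <= 2) \/ starlike e).
Proof.
have [n] := ubnP #|edges e|; elim: n e => // n IHn e lt_n te.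
have [/forallP de|] := boolP [forall x, deg e x <= 1].
  have [-> ->] := small_tree te de; split=> //; split=> // _; left=> x.
  exact: leq_trans (de x) _.
rewrite negb_forall => /existsP[c]; rewrite -ltnNge => dc.
have {n IHn lt_n} IH l : leaf e l -> deg_prod (del l e) <= F (del l e) /\
    (F (del l e) = deg_prod (del l e) <->
      (forall x, deg (del l e) x <= 2) \/ starlike (del l e)).
  move=> lf; apply: IHn (tree_del te lf); have /leafP[v elv _] := lf.
  rewrite (edges_del (tree_sym te) lf elv); move: lt_n.
  by rewrite ltnS (cardsD1 [set l; v]) edge_in.
(* Deleting a leaf preserves the degree bound and the star shape, so the induction gives equality
   for every [del l e]. *)
have F_eq : (forall x, deg e x <= 2) \/ starlike e -> F e = deg_prod e.
  case=> [de | star]; [apply: F_path dc _ | apply: F_star dc _] => // l lf;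
    apply/(proj2 (IH l lf)).
    by left=> x; apply: leq_trans (deg_restr _ _ _) (de x).
  by right; case: star => c' star; exists c' => x y /sub_restr/star.
have [/existsP[x /existsP[y exy]]|] := boolP [exists x, exists y, inner e x y].
  have [|F_ge F_deg] := F_inner te exy dc; first by move=> l /IH[].
  by split=> //; split=> [/F_deg|/F_eq] //; left.
rewrite negb_exists => /forallP no_inner.
have star : starlike e.
  apply: starlike_inner te dc _ => x y.
  by have := no_inner x; rewrite negb_exists => /forallP.
by rewrite F_eq; [split=> //; split=> // _ |]; right.
Qed.

(** * Translation to path graphs and stars *)

Lemma connected_deg_gt0 e x : connected_graph e -> 1 < #|T| -> 0 < deg e x.
Proof.
move=> conn T2; have [y] : exists y, y \in [set~ x].
  by apply/card_gt0P; move: T2; rewrite -cardsT (cardsD1 x) inE setTD.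
rewrite !inE => yx; have /connectP[[|z p] /= ep y_last] := conn x y.
  by rewrite y_last eqxx in yx.
by case/andP: ep => /deg_gt0.
Qed.

Lemma path_graphP e : tree_like e -> (forall x, 0 < deg e x) -> 1 < #|T| ->
  is_path_graph e <-> (forall x, deg e x <= 2).
Proof.
move=> te dpos T2; split=> [[s [ps eE]] | de].
  apply: (@deg_path_le2 e s) => x y; rewrite eE => adj; split=> //.
  by rewrite (perm_mem ps) mem_enum.
have /card_gt0P[a _] := ltnW T2; have /deg_gt0P[b eab] := dpos a.
have [s us eE] := tree_path te de eab.
have in_s x : x \in s by case/deg_gt0P: (dpos x) => y; rewrite eE => /and3P[].
exists s; split; last by move=> x y; rewrite eE !in_s.
by apply: uniq_perm; rewrite ?enum_uniq // => x; rewrite in_s mem_enum.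
Qed.

(** Every vertex other than [c] has an edge, which must end in [c]; so [c] is joined to all
    others. *)
Lemma is_starP e : symmetric e -> irreflexive e -> (forall x, 0 < deg e x) ->
  is_star e <-> starlike e.
Proof.
move=> esym eirr dpos; split=> -[c star]; exists c => x y.
  by rewrite star => /orP[]/andP[/eqP]; [left | right].
have ec z : z != c -> e z c.
  by move/eqP=> zc; case/deg_gt0P: (dpos z) => w ezw; case: (star _ _ ezw) => [|<-].
have [->|xc] := eqVneq x c; have [->|yc] := eqVneq y c; rewrite /= ?eirr ?ec //.
  by rewrite esym ec.
by apply/negP => /star[]/eqP; apply/negP.
Qed.
End Trees.

Theorem theorem3p8 (T : finType) (e : rel T) :
  symmetric e -> irreflexive e -> is_tree e -> 2 <= #|T| ->
  (\prod_(v : T) (deg e v)`! <= F e) /\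
  (F e = \prod_(v : T) (deg e v)`! <-> is_path_graph e \/ is_star e).
Proof.
move=> esym eirr [conn ac] T2.
have te : tree_like e by split=> // x y _ _; apply: conn.
have dpos x := connected_deg_gt0 x conn T2.
have [F_ge F_eq] := tree_like_bound te; split=> //.
have pathE := path_graphP te dpos T2; have starE := is_starP esym eirr dpos.
by rewrite -/(deg_prod e); tauto.
Qed.
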